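(* Let $\pi=\Pr(y=1)\in(0,1)$ and $p,q\in(0,1)$, and consider the majority-vote classifier built from $g_n=\sum_{i=1}^n f_i$, with error rate $\mathrm{Err}(n)$ and estimated error rate $\widehat{\mathrm{Err}}(n)$, all as defined in the context. Suppose that the limits $$\sigma_p^2=\lim_{n\to\infty}\frac{\mathrm{Var}(g_n\mid y=1)}{n},\qquad \sigma_q^2=\lim_{n\to\infty}\frac{\mathrm{Var}(g_n\mid y=0)}{n}$$ satisfy $0<\sigma_p,\sigma_q<\infty$. Then $$\lim_{n\to\infty}\mathrm{Err}(n)=\lim_{n\to\infty}\widehat{\mathrm{Err}}(n),$$ and the common limit depends on $(p,q)$ only through whether each of $p$ and $q$ is larger than, equal to, or less than $1/2$ (so that it has phase transitions at $p=1/2$ and $q=1/2$). Its value is: - if $q>1/2$: $1$ when $p<1/2$; $1-\pi/2$ when $p=1/2$; $1-\pi$ when $p>1/2$; - if $q=1/2$: $(1+\pi)/2$ when $p<1/2$; $1/2$ when $p=1/2$; $(1-\pi)/2$ when $p>1/2$; - if $q<1/2$: $\pi$ when $p<1/2$; $\pi/2$ when $p=1/2$; $0$ when $p>1/2$.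
   Context: Binary classification setting: $(\mathbf{x},y)$ is a random pair with class label $y\in\{0,1\}$ and prior probability $\pi=\Pr(y=1)\in(0,1)$. The classifiers are $f_i=f_i(\mathbf{x})=f(\mathbf{x};\theta_i)\in\{0,1\}$, $i=1,2,\dots$, where $f(\cdot;\theta)$ is a binary classifier completely parameterized by $\theta$ and $\theta_1,\theta_2,\dots$ are drawn i.i.d. from a distribution $\mathcal{P}_\theta$, independently of $(\mathbf{x},y)$. For fixed $\theta_i$, the true positive rate and false positive rate of $f_i$ are $p_i=\Pr(f(\mathbf{x};\theta_i)=1\mid y=1)$ and $q_i=\Pr(f(\mathbf{x};\theta_i)=1\mid y=0)$ (probability over $\mathbf{x}$ given $y$). Their averages are $$p=\mathrm{E}_{\mathcal{P}_\theta}(p_i)=\int \Pr(f(\mathbf{x};\theta)=1\mid y=1)\,d\mathcal{P}_\theta,\qquad q=\mathrm{E}_{\mathcal{P}_\theta}(q_i)=\int \Pr(f(\mathbf{x};\theta)=1\mid y=0)\,d\mathcal{P}_\theta,$$ and both $p$ and $q$ are assumed to lie in the open interval $(0,1)$. The majority-vote classifier uses $g_n=\sum_{i=1}^n f_i$ and predicts $\hat y=1$ if $g_n>n/2$ and $\hat y=0$ if $g_n\le n/2$. Its error rate is $$\mathrm{Err}(n)=\Pr(g_n\le n/2\mid y=1)\,\pi+\Pr(g_n>n/2\mid y=0)\,(1-\pi).$$ Here and in $\mathrm{Var}(g_n\mid y=\cdot)$, $\mathrm{E}(g_n\mid y=\cdot)$, probabilities and moments are taken over both $\mathbf{x}$ and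 the $\theta_i$, conditionally on $y$. Write $\mu_p=\mathrm{E}(g_n\mid y=1)$ and $\mu_q=\mathrm{E}(g_n\mid y=0)$, and let $\Phi$ be the cumulative distribution function of the standard normal $\mathrm{N}(0,1)$ distribution. With $\sigma_p,\sigma_q$ the nonnegative square roots of $\sigma_p^2=\lim_{n\to\infty}\mathrm{Var}(g_n\mid y=1)/n$ and $\sigma_q^2=\lim_{n\to\infty}\mathrm{Var}(g_n\mid y=0)/n$, the estimated error rate is $$\widehat{\mathrm{Err}}(n)=\Phi\!\left(\frac{n/2-\mu_p}{\sigma_p\sqrt n}\right)\pi+\left[1-\Phi\!\left(\frac{n/2-\mu_q}{\sigma_q\sqrt n}\right)\right](1-\pi).$$ *)

(* Defs.v *)
From HB Require Import structures.
From mathcomp Require Import all_boot all_order all_algebra finmap.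
From mathcomp Require Import all_classical all_reals all_analysis.

Set Implicit Arguments.
Unset Strict Implicit.
Unset Printing Implicit Defensive.

Import Order.TTheory GRing.Theory Num.Theory.
Import numFieldNormedType.Exports.

Local Open Scope classical_set_scope.
Local Open Scope ring_scope.

Section independence.
Context d (T : measurableType d) (R : realType) (P : probability T R).

Definition mutually_independent (I : choiceType) (F : I -> set (set T)) : Prop :=
  forall (J : {fset I}) (E : I -> set T),
    (forall i, i \in J -> F i (E i)) ->
    P (\bigcap_(i in [set` J]) E i) = (\prod_(i <- J) P (E i))%E.

Definition events_of d' (T' : measurableType d') (X : T -> T') : set (set T) :=
  preimage_set_system setT X measurable.

End independence.

Section conditioning.
Context d (T : measurableType d) (R : realType).

Lemma measurable_label (y : {mfun T >-> bool}) (c : bool) :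
  measurable (y @^-1` [set c]).
Proof. by rewrite -[X in measurable X]setTI; exact: measurable_funP. Qed.

(* [cond_label P y c A] is P (A `&` [y = c]) / P [y = c] whenever
   P [y = c] > 0; otherwise [mnormalize] falls back to its second argument. *)
Definition cond_label (P : probability T R) (y : {mfun T >-> bool}) (c : bool)
    : probability T R :=
  mnormalize (mrestr P (measurable_label y c)) P.

End conditioning.

Definition Phi (R : realType) (z : R) : R := fine (normal_prob 0 1 `]-oo, z]).

Section majority_vote.
Context (R : realType) d dX dT (Omega : measurableType d)
  (X : measurableType dX) (Theta : measurableType dT).
Variables (P : probability Omega R)
  (x : {RV P >-> X}) (y : {RV P >-> bool}) (theta : nat -> {RV P >-> Theta})
  (Ptheta : probability Theta R) (f : X -> Theta -> bool).

(* The data (x, y) has index [None]; [theta i], which plays the role of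
   theta_(i+1), has index [Some i]. *)
Definition sampling_events (o : option nat) : set (set Omega) :=
  if o is Some i then events_of (theta i)
  else events_of (fun w => (x w, y w)).

Definition classifier_setting : Prop :=
  [/\ measurable_fun setT (fun u : X * Theta => f u.1 u.2),
      mutually_independent P sampling_events &
      forall i, distribution P (theta i) = Ptheta :> (set Theta -> \bar R)].

Definition prior : R := fine (P (y @^-1` [set true])).

(* True positive rate ([c = true]) or false positive rate ([c = false]) of
   f(.; t) at a fixed parameter [t]. *)
Definition positive_rate (c : bool) (t : Theta) : R :=
  fine (cond_label P y c [set w | f (x w) t]).

Definition mean_rate (c : bool) : R := fine ('E_Ptheta[positive_rate c])%E.

Definition votes (n : nat) (w : Omega) : R :=
  \sum_(i < n) (f (x w) (theta i w))%:R.

Definition Err (n : nat) : R :=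
  fine (cond_label P y true [set w | votes n w <= n%:R / 2]) * prior +
  fine (cond_label P y false [set w | votes n w > n%:R / 2]) * (1 - prior).

Definition cond_mean (c : bool) (n : nat) : R :=
  fine ('E_(cond_label P y c)[votes n])%E.

Definition scaled_cond_var (c : bool) (n : nat) : \bar R :=
  ('V_(cond_label P y c)[votes n] * (n%:R^-1)%:E)%E.

Definition Err_hat (sigma_p sigma_q : R) (n : nat) : R :=
  Phi ((n%:R / 2 - cond_mean true n) / (sigma_p * Num.sqrt n%:R)) * prior +
  (1 - Phi ((n%:R / 2 - cond_mean false n) / (sigma_q * Num.sqrt n%:R))) *
    (1 - prior).

End majority_vote.

Definition limit_error (R : realType) (prior p q : R) : R :=
  if q > 1 / 2 then
    if p < 1 / 2 then 1
    else if p == 1 / 2 then 1 - prior / 2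
    else 1 - prior
  else if q == 1 / 2 then
    if p < 1 / 2 then (1 + prior) / 2
    else if p == 1 / 2 then 1 / 2
    else (1 - prior) / 2
  else
    if p < 1 / 2 then prior
    else if p == 1 / 2 then prior / 2
    else 0.

(* Main.v *)
Require Import Defs.
From HB Require Import structures.
From mathcomp Require Import all_boot all_order all_algebra finmap.
From mathcomp Require Import all_classical all_reals all_analysis.
From mathcomp Require Import measurable_realfun ring lra zify.

Set Implicit Arguments.
Unset Strict Implicit.
Unset Printing Implicit Defensive.

Import Order.TTheory GRing.Theory Num.Theory.
Import numFieldNormedType.Exports.

Local Open Scope classical_set_scope.
Local Open Scope ring_scope.

(** Condition on [y = c], write h(x) for the probability that a fresh classifier
    accepts x, and let p be its mean. For every event U about x, Cauchy-Schwarz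
    gives n |E[1_U (h - p)]| = |Cov(1_U, g_n)| <= sqrt(Var 1_U * Var g_n), which is
    O(sqrt n) when Var(g_n) / n converges; hence E[1_U h] = p P(U) for every U.
    Given y, the votes are thus i.i.d. Bernoulli(p) and g_n is binomial. When
    p <> 1/2, Chebyshev's inequality makes P(g_n <= n/2) tend to 0 or 1. When
    p = 1/2, the symmetry of the binomial distribution gives
    P(g_n <= n/2) = 1/2 + P(g_n = n/2) / 2, and the central binomial coefficient
    is o(2^n). As E(g_n | y) = n p, the argument of Phi is
    sqrt n (1/2 - p) / sigma, which leads to the same three limits. *)

(** * The standard normal distribution function: limits and value at 0 *)

Section gauss.
Context {R : realType}.

(** Under [normal_prob 0 1] the identity is a random variable with distribution function [Phi], so
    general limit theorems for distribution functions apply. *)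
Let idR : measurableTypeR R -> R := idfun.

#[local] HB.instance Definition _ :=
  @isMeasurableFun.Build _ _ _ _ idR (@measurable_id _ _ setT).

Lemma Phi_cvg_pinfty : @Phi R z @[z --> +oo] --> (1 : R).
Proof.
apply: fine_cvg.
exact: (@cvg_cdfy1 _ _ _ (normal_prob 0 1) (idR : {RV (normal_prob 0 1) >-> R})).
Qed.

Lemma Phi_cvg_ninfty : @Phi R z @[z --> -oo] --> (0 : R).
Proof.
apply: fine_cvg.
exact: (@cvg_cdfNy0 _ _ _ (normal_prob 0 1) (idR : {RV (normal_prob 0 1) >-> R})).
Qed.

(** The density is even and a point has no mass, so the half-lines on either side of 0 have equal
    masses, which add up to 1. *)
Lemma Phi0 : Phi (0 : R) = 1 / 2.
Proof.
have pdfN z : normal_pdf (0 : R) 1 (- z) = normal_pdf 0 1 z.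
  by rewrite /normal_pdf oner_eq0 /normal_fun !subr0 sqrrN.
have cpdf : continuous (normal_pdf (0 : R) 1).
  by apply: continuous_normal_pdf; rewrite oner_eq0.
have half : normal_prob (0 : R) 1 `]-oo, 0] = normal_prob (0 : R) 1 `[0, +oo[.
  rewrite /normal_prob -[X in `]-oo, X]]oppr0 ge0_integration_by_substitutionNy.
  - by apply: eq_integral => z _ /=; rewrite pdfN.
  - exact: continuous_subspaceT.
  - by move=> z _; exact: normal_pdf_ge0.
have split1 : (normal_prob (0 : R) 1 `]-oo, 0%R] +
    normal_prob (0 : R) 1 `]0%R, +oo[ = 1)%E.
  exact: (@cdf_ccdf_1 _ _ _ (normal_prob 0 1) (idR : {RV (normal_prob 0 1) >-> R})).
have oc : normal_prob (0 : R) 1 `]0, +oo[ = normal_prob (0 : R) 1 `[0, +oo[.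
  rewrite /normal_prob integral_itv_obnd_cbnd//.
  apply/measurable_EFinP; apply: measurable_funTS; exact: measurable_normal_pdf.
move: split1; rewrite oc -half /Phi.
have : normal_prob (0 : R) 1 `]-oo, 0] \is a fin_num by rewrite fin_num_measure.
case: (normal_prob (0 : R) 1 `]-oo, 0]) => //= r _ [] rr; lra.
Qed.
End gauss.

(** * The central binomial coefficient and the lower half of a binomial row *)

Section binomial.
Context {R : realType}.

(* The left-hand side times 2m + 1 is nonincreasing in m. *)
Lemma central_binomial_bound m :
  ('C(m.*2, m)%:R / 2 ^+ m.*2 : R) ^+ 2 <= (m.*2.+1)%:R^-1.
Proof.
elim: m => [|m IH]; first by rewrite /= bin0 expr0 divr1 expr1n invr1.
have rec : ('C(m.+1.*2, m.+1) * m.+1 = 'C(m.*2, m) * (m.*2.+1).*2)%N.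
  (* With the factorials of [m] and [m.+1] multiplied in, [bin_fact] eliminates both binomial
     coefficients. *)
  apply/eqP; rewrite -(eqn_pmul2l (fact_gt0 m)) -(eqn_pmul2l (fact_gt0 m.+1)).
  have h1 : (m.*2.+2 - m.+1 = m.+1)%N by lia.
  have h2 : (m.*2 - m = m)%N by lia.
  have := @bin_fact m.*2.+2 m.+1 ltac:(lia).
  have := @bin_fact m.*2 m ltac:(lia).
  rewrite h1 h2 !factS doubleS => <-.
  nia.
have recR : 'C(m.+1.*2, m.+1)%:R / 2 ^+ m.+1.*2 =
    'C(m.*2, m)%:R / 2 ^+ m.*2 * (m.*2.+1%:R / m.*2.+2%:R) :> R.
  have recR' : 'C(m.+1.*2, m.+1)%:R * m.+1%:R = 'C(m.*2, m)%:R * (m.*2.+1%:R *+ 2) :> R.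
    by rewrite -natrM rec natrM -(muln2 m.*2.+1) (natrM _ m.*2.+1) mulr_natr.
  have -> : m.*2.+2%:R = m.+1%:R * 2 :> R by rewrite -natrM; congr _%:R; lia.
  rewrite doubleS !exprS.
  have h : m.+1%:R != 0 :> R by rewrite pnatr_eq0.
  apply: (mulIf h); rewrite mulrAC recR'.
  have h2 : 2 ^+ m.*2 != 0 :> R by rewrite expf_neq0// pnatr_eq0.
  by field; rewrite h2 andbT addrC natr1.
rewrite recR exprMn.
apply: le_trans (ler_wpM2r (sqr_ge0 _) IH) _.
rewrite doubleS -(natr1 m.*2.+2) -(natr1 m.*2.+1).
have : 0 < m.*2.+1%:R :> R by rewrite ltr0n.
(* What remains is [t (t + 2) <= (t + 1) ^ 2]. *)
set t := m.*2.+1%:R => t0.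
rewrite exprMn exprVn -[X in _ <= X]mul1r ler_pdivlMr; last lra.
have -> : t^-1 * (t ^+ 2 * (t + 1) ^- 2) * (t + 1 + 1) = t * (t + 2) / (t + 1) ^+ 2.
  by field; rewrite !gt_eqF//; lra.
rewrite ler_pdivrMr ?exprn_gt0 ?mul1r//; nra.
Qed.

(** The reflection of [k] to [n - k] exchanges the strict lower and upper halves of the row, so
    doubling the lower half gives the whole row plus the middle entry, if there is one. *)
Lemma double_lower_half_bin n :
  ((\sum_(k < n.+1 | k.*2 <= n) 'C(n, k)).*2 =
    2 ^ n + \sum_(k < n.+1 | k.*2 == n) 'C(n, k))%N.
Proof.
have total : (\sum_(k < n.+1) 'C(n, k) = 2 ^ n)%N.
  rewrite -[2%N]/(1 + 1)%N expnDn; apply: eq_bigr => i _.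
  by rewrite !exp1n !muln1.
have flip : (\sum_(k < n.+1 | ~~ (k.*2 <= n)%N) 'C(n, k) =
    \sum_(k < n.+1 | (k.*2 < n)%N) 'C(n, k))%N.
  rewrite (reindex_inj rev_ord_inj) /=; apply: eq_big => [k|k _].
    by have := ltn_ord k; lia.
  by rewrite subSS bin_sub// -ltnS.
rewrite -total -addnn [X in (_ = X + _)%N](bigID (fun k : 'I_n.+1 => (k.*2 <= n)%N)) /=.
rewrite flip -addnA; congr addn.
rewrite (bigID (fun k : 'I_n.+1 => (k.*2 < n)%N)) /=.
by congr addn; apply: eq_bigl => k; lia.
Qed.

Lemma lower_half_bin_cvg :
  (\sum_(k < n.+1 | (k.*2 <= n)%N) 'C(n, k))%:R / 2 ^+ n @[n --> \oo]
    --> (1 / 2 : R).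
Proof.
(* [e n] is the chance of a tie among [n] fair votes: 0 for odd [n], a central binomial ratio for
   even [n]. The lower tail is [1 / 2 + e n / 2]. *)
pose e n : R := (\sum_(k < n.+1 | (k.*2 == n)%N) 'C(n, k))%:R / 2 ^+ n.
have e_ge0 n : 0 <= e n by rewrite divr_ge0// exprn_ge0.
have e_le n : e n <= Num.sqrt (n.+1%:R^-1).
  rewrite -(@ler_pXn2r _ 2) ?nnegrE ?sqrtr_ge0//.
  rewrite sqr_sqrtr ?invr_ge0//.
  have [on|en] := boolP (odd n).
    rewrite /e big_pred0 ?mul0r ?expr0n ?invr_ge0// => k.
    by apply/negbTE; apply: contraL on => /eqP <-; rewrite odd_double.
  have nE : n./2.*2 = n by rewrite -[RHS]odd_double_half (negbTE en).
  have n2 : (n./2 < n.+1)%N by lia.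
  rewrite /e (big_pred1 (Ordinal n2)) => [|k] /=.
    by rewrite -nE doubleK; exact: central_binomial_bound.
  by apply/eqP/eqP => [kn|->//]; apply: val_inj => /=; rewrite -(doubleK k) kn.
have e0 : e n @[n --> \oo] --> (0 : R).
  apply: (@squeeze_cvgr _ _ _ _ (cst 0) (fun n => Num.sqrt (n.+1%:R^-1))).
  - by near=> n; rewrite e_ge0 e_le.
  - exact: cvg_cst.
  - rewrite -[X in _ --> X]sqrtr0.
    apply: (@cvg_comp _ _ _ (fun n => n.+1%:R^-1) Num.sqrt).
      exact: cvg_harmonic.
    exact: sqrt_continuous.
have -> : (fun n => (\sum_(k < n.+1 | (k.*2 <= n)%N) 'C(n, k))%:R / 2 ^+ n) =
    (fun n => 1 / 2 + e n / 2 : R).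
  apply/funext => n; have := double_lower_half_bin n.
  rewrite -addnn => /(congr1 (fun i => i%:R : R)).
  rewrite !natrD natrX /e => h.
  have h2 : 2 ^+ n != 0 :> R by rewrite expf_neq0// pnatr_eq0.
  have -> : (\sum_(k < n.+1 | k.*2 == n) 'C(n, k))%:R =
      (\sum_(k < n.+1 | (k.*2 <= n)%N) 'C(n, k))%:R *+ 2 - 2 ^+ n :> R.
    by rewrite mulr2n h addrAC subrr add0r.
  by field.
rewrite -[X in _ --> X]addr0; apply: cvgD; first exact: cvg_cst.
by rewrite -[X in _ --> X](mul0r 2^-1); apply: cvgMr_tmp.
Unshelve. all: by end_near. Qed.
End binomial.

(* The common limit of P(g_n <= n/2 | y) and of its normal approximation. *)
Definition half_step {R : realType} (p : R) : R :=
  if p < 1 / 2 then 1 else if p == 1 / 2 then 1 / 2 else 0.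

(** The argument of [Phi] is [(1 / 2 - p) / s] times the square root of [n], so the sign of
    [1 / 2 - p] decides the limit. *)
Lemma Phi_standardized_cvg {R : realType} (p s : R) : 0 < s ->
  Phi ((n%:R / 2 - n%:R * p) / (s * Num.sqrt n%:R)) @[n --> \oo] --> half_step p.
Proof.
move=> s0.
have argE n : (n%:R / 2 - n%:R * p) / (s * Num.sqrt n%:R) =
    (1 / 2 - p) / s * Num.sqrt n%:R.
  have [->|n0] := posnP n; first by rewrite sqrtr0 !mul0r subr0 mul0r mulr0.
  have q0 : 0 < Num.sqrt n%:R :> R by rewrite sqrtr_gt0 ltr0n.
  rewrite -[X in X / 2 - X * p](@sqr_sqrtr _ n%:R)//.
  by field; rewrite !gt_eqF.
under eq_cvg do rewrite argE.
have sqrty : Num.sqrt n%:R @[n --> \oo] --> (+oo : set_system R).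
  apply/cvgryPge => A; near=> n.
  apply: le_trans (ler_norm _) _; rewrite -sqrtr_sqr ler_wsqrtr//.
  apply: le_trans (ler_norm _) _; apply: le_trans (ltW (archi_boundP (normr_ge0 _))) _.
  by rewrite ler_nat; near: n; exact: nbhs_infty_ge.
have Msqrty M : 0 < M -> M * Num.sqrt n%:R @[n --> \oo] --> (+oo : set_system R).
  by move=> M0; apply: (cvg_comp _ ( *%R M) sqrty (gt0_cvgMry M0 cvg_id)).
rewrite /half_step; case: ltgtP => p12.
- apply: (@cvg_comp _ _ _ _ (@Phi R) _ _ _ _ Phi_cvg_pinfty); apply: Msqrty.
  by rewrite divr_gt0// subr_gt0.
- apply: (@cvg_comp _ _ _ _ (@Phi R) _ _ _ _ Phi_cvg_ninfty); apply/cvgNry.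
  have -> : - (fun n => (1 / 2 - p) / s * Num.sqrt n%:R) =
      (fun n => (p - 1 / 2) / s * Num.sqrt n%:R).
    by apply/funext => n; rewrite fctE; ring.
  by apply: Msqrty; rewrite divr_gt0// subr_gt0.
- have -> : (fun n => Phi ((1 / 2 - p) / s * Num.sqrt n%:R)) = cst (1 / 2).
    by apply/funext => n; rewrite p12 subrr !mul0r Phi0.
  exact: cvg_cst.
Unshelve. all: by end_near. Qed.

(** * Uniqueness of finite measures on a product space *)

Section product.
Context d1 d2 (T1 : measurableType d1) (T2 : measurableType d2) (R : realType).
Local Open Scope ereal_scope.

(** Rectangles are stable under intersection and generate the product sigma-algebra. This carries
    identities from rectangles over to the acceptance set of the classifier, which need not be
    one. *)
Lemma finite_measure_prod_unique (m1 m2 : {measure set (T1 * T2) -> \bar R}) :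
  m1 setT < +oo ->
  (forall A B, measurable A -> measurable B ->
    m1 (A `*` B) = m2 (A `*` B)) ->
  forall C, measurable C -> m1 C = m2 C.
Proof.
move=> m1oo m12 C mC.
apply: (measure_unique
  [set A `*` B | A in measurable & B in measurable] (fun=> setT)) => //.
- exact: measurable_prod_measurableType.
- move=> _ _ [A1 mA1 [B1 mB1 <-]] [A2 mA2 [B2 mB2 <-]].
  rewrite -setXI; exists (A1 `&` A2); first exact: measurableI.
  by exists (B1 `&` B2) => //; exact: measurableI.
- by move=> _; exists setT => //; exists setT => //; rewrite setXTT.
- by rewrite bigcup_const.
- by move=> _ [A mA [B mB <-]]; exact: m12.
Qed.
End product.

(** * Vote counts when features and parameters are independent *)

Section votes.
Context (R : realType) d dX dT (Omega : measurableType d)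
  (X : measurableType dX) (Theta : measurableType dT).
Variables (Q : probability Omega R)
  (x : {RV Q >-> X}) (theta : nat -> {RV Q >-> Theta})
  (mu : probability Theta R) (f : X -> Theta -> bool).

Hypothesis mf : measurable_fun setT (fun u : X * Theta => f u.1 u.2).
(** One equation holds both the joint independence of [x] and the draws and the common law [mu] of
    the draws; [cond_independence] supplies it given a label. *)
Hypothesis indep : forall U (B : nat -> set Theta) r,
  measurable U -> (forall j, measurable (B j)) ->
  Q (x @^-1` U `&` \bigcap_(j in `I_r) theta j @^-1` B j) =
  (Q (x @^-1` U) * \prod_(j < r) mu (B j))%E.

Let accept : set (X * Theta) := [set u | f u.1 u.2].
Let hit i : set Omega := [set w | f (x w) (theta i w)].

Let mpreX U : measurable U -> measurable (x @^-1` U).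
Proof. by move=> mU; rewrite -[X in measurable X]setTI; exact: measurable_funPT. Qed.

Let mpreT i B : measurable B -> measurable (theta i @^-1` B).
Proof. by move=> mB; rewrite -[X in measurable X]setTI; exact: measurable_funPT. Qed.

Let xth i w := (x w, theta i w).
Let mxth i : measurable_fun setT (xth i).
Proof. by apply: measurable_fun_pair; exact: measurable_funPT. Qed.

Let mprexth i C : measurable C -> measurable (xth i @^-1` C).
Proof. by move=> mC; rewrite -[X in measurable X]setTI; exact: mxth. Qed.

Let maccept : measurable accept.
Proof.
rewrite -[X in measurable X]setTI.
by have := mf measurableT (Y := [set true]); apply.
Qed.

Let mhit i : measurable (hit i).
Proof. exact: (mprexth i maccept). Qed.

(** [hit i] is the preimage of [accept] under [xth i], so two finite measures on the product space
    need only be compared on rectangles. *)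
Lemma transfer_hit (A1 A2 : set Omega) (k : {nonneg R}) i j :
  measurable A1 -> measurable A2 ->
  (forall U B, measurable U -> measurable B ->
    Q (A1 `&` (x @^-1` U `&` theta i @^-1` B)) =
    k%:num%:E * Q (A2 `&` (x @^-1` U `&` theta j @^-1` B)))%E ->
  Q (A1 `&` hit i) = (k%:num%:E * Q (A2 `&` hit j))%E.
Proof.
move=> mA1 mA2 rect.
have /(_ (mxth i) (mxth j)) := @finite_measure_prod_unique _ _ X Theta R
  (pushforward (mrestr Q mA1) (xth i))
  (mscale k (pushforward (mrestr Q mA2) (xth j))).
move=> /(_ _ _ _ maccept); rewrite /= /mscale /= /pushforward /mrestr /=.
rewrite ![xth _ @^-1` _ `&` _]setIC; apply.
  by rewrite preimage_setT setIT ltey_eq fin_num_measure.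
by move=> U B mU mB; rewrite setIC rect// setIC.
Qed.

Lemma feature_parameter_indep U B i : measurable U -> measurable B ->
  Q (x @^-1` U `&` theta i @^-1` B) = (Q (x @^-1` U) * mu B)%E.
Proof.
move=> mU mB.
(* Only draw [i] is constrained; the other sets are [setT], of mass 1. *)
have := @indep U (fun j => if j == i then B else setT) i.+1 mU.
rewrite (bigD1 ord_max)//= eqxx big1 ?mule1; last first.
  by move=> j ji; rewrite ifN ?probability_setT.
move=> <-; last by move=> j; case: ifP.
congr (Q (_ `&` _)); apply/seteqP; split=> w /=.
  by move=> Bw j /= _; case: eqP => [->|].
by move=> /(_ i (ltnSn i)) /=; rewrite eqxx.
Qed.

(** All pairs [xth i] have the same product law, so [transfer_hit] applies with factor 1. *)
Lemma hit_same_law U i : measurable U ->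
  Q (x @^-1` U `&` hit i) = Q (x @^-1` U `&` hit 0%N).
Proof.
move=> mU; rewrite (@transfer_hit _ _ 1%:nng _ 0%N (mpreX mU) (mpreX mU)) ?mul1e//.
move=> U' B mU' mB.
by rewrite mul1e !setIA -preimage_setI !feature_parameter_indep//; exact: measurableI.
Qed.

Let p := fine (Q (hit 0%N)).

Let hitE i : Q (hit i) = p%:E.
Proof.
rewrite fineK ?fin_num_measure// -(setTI (hit i)) -(setTI (hit 0)).
by rewrite -(preimage_setT x) hit_same_law.
Qed.

Lemma hit_mean : Q (hit 0%N) = 'E_mu[fun t => fine (Q [set w | f (x w) t])]%E.
Proof.
(* The version [\x^] of the product measure integrates the mass of each section over the parameter,
   which is the expectation sought. *)
have /(_ (mxth 0%N)) := @finite_measure_prod_unique _ _ X Theta R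
  (pushforward Q (xth 0%N)) (distribution Q x \x^ mu)%E.
move=> /(_ _ _ _ maccept) /= uniq.
rewrite -[LHS]/(pushforward Q (xth 0%N) accept) uniq; last 2 first.
- by rewrite /pushforward preimage_setT ltey_eq fin_num_measure.
- by move=> U B mU mB; rewrite [RHS]product_measure2E//= -(feature_parameter_indep 0%N).
rewrite unlock; apply: eq_integral => t _ /=.
have -> : [set w | f (x w) t] = x @^-1` ysection accept t.
  by rewrite ysectionE.
rewrite fineK//; apply: fin_num_measure; apply: mpreX; exact: measurable_ysection.
Qed.

Let V n : Omega -> R := votes x theta f n.

Let VE n : V n = \sum_(i < n) \1_(hit i).
Proof.
apply/funext => w; rewrite fct_sumE; apply: eq_bigr => i _.
rewrite indicE; congr (nat_of_bool _)%:R.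
by apply/idP/idP => [|/set_mem]//; exact: mem_set.
Qed.

Let Lfun_indic (A : set Omega) (r : R) : 0 < r -> measurable A ->
  (\1_A : Omega -> R) \in Lfun Q r%:E.
Proof.
move=> r0 mA; rewrite inE/=; apply/andP; split.
  by apply: mem_set; exact: measurable_indic.
apply: mem_set.
rewrite /= /finite_norm unlock /Lnorm poweR_lty//.
rewrite (@eq_integral _ _ _ _ _ (EFin \o \1_A)) => [|w _].
  by rewrite /= integral_indic// setIT ltey_eq fin_num_measure.
by rewrite /= indicE; case: (_ \in _); rewrite ?normr1 ?powR1// normr0 powR0// gt_eqF.
Qed.

Let LV2 n : V n \in Lfun Q 2%:E.
Proof.
rewrite VE; apply: rpred_sum; first by rewrite /= lee_fin ler1n.
by move=> *; rewrite Lfun_indic.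
Qed.

Lemma measurable_votes n : measurable_fun setT (V n).
Proof. exact: set_mem (sub_Lfun_mfun (LV2 n)). Qed.

HB.instance Definition _ n :=
  isMeasurableFun.Build _ _ _ _ (V n) (measurable_votes n).

Lemma votes_mean n : ('E_Q[V n] = (n%:R * p)%:E)%E.
Proof.
rewrite VE; elim: n => [|n IH].
  by rewrite big_ord0 expectation_cst mul0r.
rewrite big_ord_recr /= expectationD.
- by rewrite IH expectation_indic// hitE -EFinD -natr1 mulrDl mul1r.
- by rewrite rpred_sum//= => i _; rewrite Lfun_indic.
- by rewrite Lfun_indic.
Qed.

Let Q_Lfun12 := @Lfun_subset12 _ _ _ Q (fin_num_measure Q _ measurableT).

Let mul_indic (A B : set Omega) : \1_A * \1_B = \1_(A `&` B) :> (Omega -> R).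
Proof. by rewrite indicI. Qed.

(** By [hit_same_law] every vote contributes equally to this mixed moment, which serves to compute a
    covariance below. *)
Let votes_indic_mean U n : measurable U ->
  ('E_Q[\1_(x @^-1` U) * V n]%R =
    (n%:R * fine (Q (x @^-1` U `&` hit 0%N)))%:E)%E.
Proof.
move=> mU; rewrite VE mulr_sumr; elim: n => [|n IH].
  by rewrite big_ord0 expectation_cst mul0r.
rewrite big_ord_recr /= expectationD.
- rewrite IH mul_indic expectation_indic; last first.
    by apply: measurableI => //; exact: mpreX.
  by rewrite hit_same_law// -[X in (_ + X)%E]fineK ?fin_num_measure//; [
    rewrite -EFinD -natr1 mulrDl mul1r|apply: measurableI => //; exact: mpreX].
- rewrite rpred_sum//= => i; rewrite mul_indic Lfun_indic//.
  by apply: measurableI => //; exact: mpreX.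
- rewrite mul_indic Lfun_indic//.
  by apply: measurableI => //; exact: mpreX.
Qed.

(** * Consequences of a variance of order [n] *)

Section bounded_variance.
Variable K : R.
Hypothesis VK : \forall n \near \oo, ('V_Q[V n] <= (K * n%:R)%:E)%E.

(** A positive gap [delta] would make the covariance grow linearly in [n], while the variance bound
    allows only the order of the square root of [n]. *)
Let hit_features_le U : measurable U ->
  fine (Q (x @^-1` U `&` hit 0%N)) <= fine (Q (x @^-1` U)) * p.
Proof.
move=> mU; rewrite leNgt; apply/negP; rewrite -subr_gt0.
set delta := _ - _ => delta0.
have mU1 : measurable (x @^-1` U) by exact: mpreX.
have L1 : (\1_(x @^-1` U) : Omega -> R) \in Lfun Q 2%:E by exact: Lfun_indic.
pose v := fine 'V_Q[\1_(x @^-1` U) : Omega -> R]%E.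
have v0 : 0 <= v by rewrite fine_ge0// variance_ge0.
(* Cauchy-Schwarz for Cov(1_U, g_n) = n delta. *)
have ineq n : ('V_Q[V n] <= (K * n%:R)%:E)%E ->
    n%:R * delta ^+ 2 <= v * K \/ n = 0%N.
  case: n => [|n]; first by right.
  move=> Vn; left.
  have := covariance_le L1 (LV2 n.+1).
  rewrite covarianceE ?votes_indic_mean ?expectation_indic ?votes_mean//; last 3 first.
  - exact: Q_Lfun12.
  - exact: Q_Lfun12.
  - exact: Lfun2_mul_Lfun1.
  rewrite -[Q (x @^-1` U)]fineK ?fin_num_measure// -EFinM -EFinB.
  have -> : n.+1%:R * fine (Q (x @^-1` U `&` hit 0%N)) -
    fine (Q (x @^-1` U)) * (n.+1%:R * p) = n.+1%:R * delta by rewrite /delta; ring.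
  move: Vn; rewrite -[variance Q (V _)]fineK ?variance_fin_num//.
  rewrite -[variance Q \1_(_)]fineK ?variance_fin_num// -/v.
  rewrite lee_fin /= lee_fin => Vn cs.
  have n0 : 0 < n.+1%:R :> R by rewrite ltr0n.
  rewrite -(ler_pM2l n0).
  have : (n.+1%:R * delta) ^+ 2 <= v * (K * n.+1%:R).
    apply: le_trans (_ : (Num.sqrt v * Num.sqrt (fine 'V_Q[V n.+1]%E)) ^+ 2 <= _).
      by rewrite ler_pXn2r// nnegrE ?mulr_ge0 ?sqrtr_ge0// ltW//.
    by rewrite exprMn !sqr_sqrtr ?fine_ge0 ?variance_ge0// ler_wpM2l.
  by move=> h; apply: le_trans (le_trans h _); rewrite ?exprMn; nra.
case: VK => N _ VN.
(* Any index from [M] on breaks the inequality in [ineq]; [N] gives access to the variance bound,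
   and the successor in [M.+1] excludes [n = 0]. *)
pose M := Num.bound `|v * K / delta ^+ 2|.
have [|] := ineq (maxn N M.+1) (VN _ (leq_maxl _ _)); last by lia.
apply/negP; rewrite -ltNge -ltr_pdivrMr ?exprn_gt0//.
apply: le_lt_trans (ler_norm _) _.
apply: lt_le_trans (archi_boundP (normr_ge0 _)) _.
by rewrite ler_nat -/M; lia.
Qed.

(** The inequality [hit_features_le] is applied to [U] and to its complement. Both sides then add up
    to [p], so each inequality is an equality. *)
Lemma hit_features_indep U : measurable U ->
  Q (x @^-1` U `&` hit 0%N) = (Q (x @^-1` U) * p%:E)%E.
Proof.
move=> mU.
have mU1 := mpreX mU.
have mU' := measurableC mU.
have := hit_features_le mU' ; have := hit_features_le mU.
rewrite preimage_setC probability_setC// [~` _ `&` _]setIC -setDE.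
rewrite measureD//; last by rewrite ltey_eq fin_num_measure.
rewrite [hit 0%N `&` _]setIC.
have : Q (x @^-1` U `&` hit 0%N) \is a fin_num.
  by rewrite fin_num_measure//; exact: measurableI.
have : Q (x @^-1` U) \is a fin_num by rewrite fin_num_measure.
rewrite [X in (X - _)%E](hitE 0%N) -![(fun a => U (x a))]/(x @^-1` U).
case: (Q _) => //= u _; case: (Q _) => //= a _.
rewrite -EFinM => h1 h2; congr _%:E; apply/eqP; rewrite eq_le h1 /=; lra.
Qed.

Let inv_nat_cvg0 (c : R) : c / n%:R @[n --> \oo] --> (0 : R).
Proof.
rewrite -(cvg_shiftS (fun n => c / n%:R)) /=.
have : c * harmonic n @[n --> \oo] --> c * (0 : R).
  by apply: cvgMl_tmp; exact: cvg_harmonic.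
by rewrite mulr0.
Qed.

Let le_fineQ (A B : set Omega) : measurable A -> measurable B -> A `<=` B ->
  fine (Q A) <= fine (Q B).
Proof.
move=> mA mB AB; apply: fine_le; rewrite ?fin_num_measure//.
by apply: le_measure; rewrite ?inE.
Qed.

Let fineQC (A : set Omega) : measurable A -> fine (Q (~` A)) = 1 - fine (Q A).
Proof. by move=> mA; rewrite probability_setC// fineB ?fin_num_measure. Qed.

Let mdev eps n : measurable [set w | n%:R * eps <= `|V n w - n%:R * p|].
Proof.
rewrite -[X in measurable X]setTI; apply: measurable_fun_le => //.
by apply: measurableT_comp => //; exact: measurable_funB.
Qed.

Let mtail n : measurable [set w | V n w <= n%:R / 2].
Proof.
by rewrite -[X in measurable X]setTI; apply: measurable_fun_le.
Qed.

(** Chebyshev's inequality at distance [n * eps]: a variance of order [n] divided by a square of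
    order [n ^ 2]. *)
Let deviation eps n : 0 < eps -> (0 < n)%N -> ('V_Q[V n] <= (K * n%:R)%:E)%E ->
  fine (Q [set w | n%:R * eps <= `|V n w - n%:R * p|]) <= K / eps ^+ 2 / n%:R.
Proof.
move=> e0 n0 Vn.
have n0' : 0 < n%:R :> R by rewrite ltr0n.
have := @chebyshev _ _ _ Q (V n) (n%:R * eps) (mulr_gt0 n0' e0).
rewrite votes_mean /= => cheb; rewrite -lee_fin fineK ?fin_num_measure//.
apply: le_trans cheb _.
apply: le_trans (lee_wpmul2l _ Vn) _.
  by rewrite lee_fin invr_ge0 exprn_ge0 ?mulr_ge0// ltW.
rewrite -EFinM lee_fin le_eqVlt; apply/orP; left; apply/eqP.
by field; rewrite !gt_eqF.
Qed.

(** A count above [n / 2] exceeds the mean by at least [n (1 / 2 - p)], so [deviation] bounds the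
    complementary event. *)
Lemma votes_tail_lt_half : p < 1 / 2 ->
  fine (Q [set w | V n w <= n%:R / 2]) @[n --> \oo] --> (1 : R).
Proof.
move=> p12; have e0 : 0 < 1 / 2 - p by lra.
apply: (@squeeze_cvgr _ _ _ _ (fun n => 1 - K / (1 / 2 - p) ^+ 2 / n%:R) (cst 1)).
- near=> n; apply/andP; split; last first.
    by rewrite -lee_fin fineK ?fin_num_measure// probability_le1.
  have n0 : (0 < n)%N by near: n; exact: nbhs_infty_gt.
  have n0' : 0 < n%:R :> R by rewrite ltr0n.
  rewrite lerBlDr -lerBlDl -fineQC//.
  apply: le_trans (deviation e0 n0 _); last by near: n.
  apply: le_fineQ => //; first exact: measurableC.
  move=> w /= /negP; rewrite -ltNge => h.
  apply: le_trans (ler_norm _).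
  by rewrite mulrBr; lra.
- rewrite -[X in _ --> X]subr0; apply: cvgB; [exact: cvg_cst|exact: inv_nat_cvg0].
- exact: cvg_cst.
Unshelve. all: by end_near. Qed.

(** Here the tail itself is the deviation: it lies at least [n (p - 1 / 2)] below the mean. *)
Lemma votes_tail_gt_half : p > 1 / 2 ->
  fine (Q [set w | V n w <= n%:R / 2]) @[n --> \oo] --> (0 : R).
Proof.
move=> p12; have e0 : 0 < p - 1 / 2 by lra.
apply: (@squeeze_cvgr _ _ _ _ (cst 0) (fun n => K / (p - 1 / 2) ^+ 2 / n%:R)).
- near=> n; rewrite fine_ge0//=.
  have n0 : (0 < n)%N by near: n; exact: nbhs_infty_gt.
  apply: le_trans (deviation e0 n0 _); last by near: n.
  apply: le_fineQ => // w /= h; rewrite distrC.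
  apply: le_trans (ler_norm _).
  by rewrite mulrBr; lra.
- exact: cvg_cst.
- exact: inv_nat_cvg0.
Unshelve. all: by end_near. Qed.
End bounded_variance.

(** * The binomial law of the vote count *)

Let count n w : nat := (\sum_(i < n) f (x w) (theta i w))%N.

Let V_count n w : V n w = (count n w)%:R.
Proof. by rewrite /V /votes /count natr_sum. Qed.

Let mcount n k : measurable [set w | count n w = k].
Proof.
have -> : [set w | count n w = k] = V n @^-1` [set k%:R].
  apply/seteqP; split => w /=; rewrite V_count; first by move=> ->.
  by move=> /eqP; rewrite eqr_nat => /eqP.
by rewrite -[X in measurable X]setTI; exact: measurable_votes.
Qed.

Let mcount_le n m : measurable [set w | (count n w <= m)%N].
Proof.
have -> : [set w | (count n w <= m)%N] = [set w | V n w <= m%:R].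
  by apply/seteqP; split => w /=; rewrite V_count ler_nat.
by rewrite -[X in measurable X]setTI; apply: measurable_fun_le.
Qed.

(** Constraints are indexed relative to [n], so that constraining draw [n] as well amounts to
    prepending a set with [scons]. *)
Let future n (B : nat -> set Theta) r : set Omega :=
  \bigcap_(j in `I_r) theta (n + j) @^-1` B j.

Let scons (C : set Theta) (B : nat -> set Theta) j :=
  if j is j'.+1 then B j' else C.

Let future_cons n C B r :
  future n (scons C B) r.+1 = theta n @^-1` C `&` future n.+1 B r.
Proof.
apply/seteqP; split => w /=.
  move=> h; split; first by have := h 0%N isT; rewrite addn0.
  by move=> j jr; have := h j.+1 jr; rewrite /= addnS -addSn.
by move=> [h0 h] [|j] jr /=; rewrite ?addn0// addnS -addSn; exact: h.
Qed.

Let mfuture n B r : (forall j, measurable (B j)) -> measurable (future n B r).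
Proof. by move=> mB; apply: bigcap_measurableType => j _; exact: mpreT. Qed.

Let binom_weight n k : R := 'C(n, k)%:R * p ^+ k * (1 - p) ^+ (n - k).

Let p01 : 0 <= p <= 1.
Proof.
by rewrite /p fine_ge0//= -lee_fin fineK ?fin_num_measure// probability_le1.
Qed.

Let binom_weight_ge0 n k : 0 <= binom_weight n k.
Proof.
by case/andP: p01 => p0 p1; rewrite !mulr_ge0 ?exprn_ge0 ?subr_ge0.
Qed.

Let binom_weight0 n : binom_weight n.+1 0 = binom_weight n 0 * (1 - p).
Proof. by rewrite /binom_weight !bin0 !expr0 !subn0 exprSr mulrA. Qed.

Let binom_weightS n k :
  binom_weight n.+1 k.+1 = binom_weight n k.+1 * (1 - p) + binom_weight n k * p.
Proof.
rewrite /binom_weight binS natrD subSS.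
(* For [n <= k] the truncated exponent [n - k.+1] is wrong for the recursion, but its coefficient
   vanishes. *)
have [nk|kn] := leqP n k.
  by rewrite bin_small ?ltnS// !mul0r !add0r exprSr; ring.
by rewrite -(subnSK kn) !exprSr; ring.
Qed.

(* Tracking arbitrary constraints [B] on the r parameters still to be drawn is
   what keeps the n-th draw independent of the count in the induction step. *)
Lemma binomial_law : (forall U, measurable U ->
    Q (x @^-1` U `&` hit 0%N) = (Q (x @^-1` U) * p%:E)%E) ->
  forall n k U B r, measurable U -> (forall j, measurable (B j)) ->
  Q (x @^-1` U `&` ([set w | count n w = k] `&` future n B r)) =
  (binom_weight n k * (fine (Q (x @^-1` U)) * \prod_(j < r) fine (mu (B j))))%:E.
Proof.
move=> decoupled; elim=> [|n IH] k U B r mU mB.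
  case: k => [|k].
    rewrite /binom_weight bin0 expr0 expr0 !mul1r.
    have -> : [set w | count 0%N w = 0%N] = setT.
      by apply/seteqP; split => w //= _; rewrite /count big_ord0.
    rewrite setTI indep// EFinM fineK ?fin_num_measure//; last exact: mpreX.
    congr (_ * _)%E; rewrite -prodEFin; apply: eq_bigr => j _.
    by rewrite fineK ?fin_num_measure.
  rewrite /binom_weight bin0n !mul0r.
  have -> : [set w | count 0%N w = k.+1] = set0.
    by apply/seteqP; split => w //=; rewrite /count big_ord0.
  by rewrite set0I setI0 measure0.
pose A l := x @^-1` U `&` ([set w | count n w = l] `&` future n.+1 B r).
have mA l : measurable (A l).
  by apply: measurableI; [exact: mpreX|apply: measurableI => //; exact: mfuture].
pose c := fine (Q (x @^-1` U)) * \prod_(j < r) fine (mu (B j)).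
(* The induction hypothesis is used with [U] shrunk to its intersection with [U'] and with [C]
   prepended as the constraint on draw [n], which [A l] leaves free. *)
have AE l U' C : measurable U' -> measurable C ->
    Q (A l `&` (x @^-1` U' `&` theta n @^-1` C)) =
    (binom_weight n l * (fine (Q (x @^-1` (U `&` U'))) *
      (fine (mu C) * \prod_(j < r) fine (mu (B j)))))%:E.
  move=> mU' mC.
  have := IH l (U `&` U') (scons C B) r.+1 (measurableI _ _ mU mU').
  rewrite big_ord_recl /= future_cons => <-; last by case.
  by congr (Q _); rewrite /A preimage_setI; apply/seteqP; split => w /=; tauto.
have QA l : Q (A l) = (binom_weight n l * c)%:E.
  have := AE l setT setT measurableT measurableT.
  by rewrite !preimage_setT !setIT probability_setT /= mul1r.
have Qhit l : Q (A l `&` hit n) = (binom_weight n l * c * p)%:E.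
  have c0 : 0 <= binom_weight n l * \prod_(j < r) fine (mu (B j)).
    by rewrite mulr_ge0// prodr_ge0// => j _; rewrite fine_ge0.
  (* On [A l] the pair of [x] and draw [n] has, up to the constant in [c0], the law of [x] and draw
     0 on the event that [x] lies in [U]; there [decoupled] applies. *)
  rewrite (@transfer_hit _ (x @^-1` U) (NngNum c0) _ 0%N (mA l) (mpreX mU)) /=.
    rewrite decoupled// -[Q (x @^-1` U)]fineK ?fin_num_measure//; last exact: mpreX.
    by rewrite -!EFinM; congr _%:E; rewrite /c; ring.
  move=> U' C mU' mC; rewrite AE// setIA -preimage_setI.
  rewrite feature_parameter_indep//; last exact: measurableI.
  have mUU : measurable (x @^-1` (U `&` U')) by apply: mpreX; exact: measurableI.
  rewrite -[Q (x @^-1` _)]fineK ?fin_num_measure// -[mu C]fineK ?fin_num_measure//.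
  by rewrite -!EFinM; congr _%:E; rewrite /=; ring.
have Qmiss l : Q (A l `\` hit n) = (binom_weight n l * c * (1 - p))%:E.
  rewrite measureD//; last by rewrite ltey_eq fin_num_measure.
  by rewrite [X in (X - _)%E]QA [X in (_ - X)%E]Qhit -EFinB mulrBr mulr1.
have countS w : count n.+1 w = (count n w + f (x w) (theta n w))%N.
  by rewrite /count big_ord_recr.
case: k => [|k].
  rewrite binom_weight0 -mulrA [(1 - p) * _]mulrC mulrA -Qmiss; congr (Q _).
  apply/seteqP; split => w; rewrite /A /hit /=.
    rewrite countS => -[Uw [/eqP + Fw]]; rewrite addn_eq0 => /andP[/eqP n0 f0].
    by split => // fw; rewrite fw in f0.
  move=> [[Uw [n0 Fw]] /negP/negbTE fw]; split=> //; split=> //.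
  by rewrite countS n0 fw.
(* A count of [k.+1] arises from [k.+1] by a miss or from [k] by a hit, matching Pascal's rule in
   [binom_weightS]. *)
have -> : x @^-1` U `&` ([set w | count n.+1 w = k.+1] `&` future n.+1 B r) =
    (A k.+1 `\` hit n) `|` (A k `&` hit n).
  apply/seteqP; split => w; rewrite /A /hit /= countS.
    case: (f (x w) (theta n w)); rewrite ?addn0 ?addn1 => -[Uw [ck Fw]].
      by right; case: ck.
    by left.
  move=> [[[Uw [ck Fw]] /negP/negbTE fw]|[[Uw [ck Fw]] fw]].
    by rewrite fw ck addn0.
  by rewrite fw ck addn1.
rewrite measureU; last 3 first.
- exact: measurableD.
- exact: measurableI.
- by apply/seteqP; split => // w [[_ nh] [_ h]].
rewrite [X in (X + _)%E]Qmiss [X in (_ + X)%E]Qhit -EFinD.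
by congr _%:E; rewrite binom_weightS /c; ring.
Qed.

Lemma votes_half_law n : (forall U, measurable U ->
    Q (x @^-1` U `&` hit 0%N) = (Q (x @^-1` U) * p%:E)%E) ->
  p = 1 / 2 ->
  fine (Q [set w | V n w <= n%:R / 2]) =
  (\sum_(k < n.+1 | (k.*2 <= n)%N) 'C(n, k))%:R / 2 ^+ n.
Proof.
move=> decoupled p12.
have law k : Q [set w | count n w = k] = ('C(n, k)%:R / 2 ^+ n)%:E.
  have := binomial_law decoupled n k 0 measurableT (fun=> measurableT).
  have -> : future n (fun=> setT) 0 = setT by rewrite /future II0 bigcap_set0.
  rewrite preimage_setT setTI setIT probability_setT big_ord0 !mulr1 /= => ->.
  congr _%:E; rewrite /binom_weight p12 -mulrA.
  (* For [k > n] the two exponents do not add up to [n], but the binomial coefficient is 0. *)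
  have [kn|nk] := leqP k n; last by rewrite bin_small// !mul0r.
  have -> : 1 - 1 / 2 = 1 / 2 :> R by lra.
  by rewrite -exprD subnKC// div1r exprVn.
have cumul m : Q [set w | (count n w <= m)%N] =
    (\sum_(k < m.+1) 'C(n, k)%:R / 2 ^+ n)%:E.
  elim: m => [|m IH].
    rewrite big_ord_recr big_ord0 /= add0r -law; congr (Q _).
    by apply/seteqP; split => w /=; rewrite leqn0 => /eqP.
  rewrite big_ord_recr /= EFinD -IH -law -measureU //.
  - congr (Q _); apply/seteqP; split => w /=.
      by rewrite leq_eqVlt => /orP[/eqP|]; [right|left].
    by case=> [/leqW|->].
  - by apply/seteqP; split => // w /= [] /[swap] ->; rewrite ltnn.
(* The count is an integer, so the real threshold may be rounded down. *)
have -> : [set w | V n w <= n%:R / 2] = [set w | (count n w <= n./2)%N].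
  apply/seteqP; split => w /=; rewrite V_count ler_pdivlMr ?ltr0n// -natrM ler_nat; lia.
rewrite cumul /= -mulr_suml -natr_sum; congr (_%:R / _).
rewrite (big_ord_widen n.+1 (fun k => 'C(n, k))); last by lia.
by apply: eq_bigl => k; lia.
Qed.

Lemma votes_tail_cvg (s : R) :
  ('V_Q[V n] * (n%:R^-1)%:E)%E @[n --> \oo] --> s%:E ->
  fine (Q [set w | V n w <= n%:R / 2]) @[n --> \oo] --> half_step p.
Proof.
move=> /fine_cvgP[_ Vs].
(* The scaled variance is eventually below [s + 1], a constant above its limit. *)
have VK : \forall n \near \oo, ('V_Q[V n] <= ((s + 1) * n%:R)%:E)%E.
  near=> n.
  have n0 : 0 < n%:R :> R by rewrite ltr0n; near: n; exact: nbhs_infty_gt.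
  have : fine ('V_Q[V n] * (n%:R^-1)%:E)%E <= s + 1.
    by near: n; apply: (cvgr_le s) => //; rewrite ltrDl.
  rewrite -[variance Q (V n)]fineK ?variance_fin_num// -EFinM /=.
  by rewrite ler_pdivrMr// lee_fin.
rewrite /half_step; case: ltgtP => p12.
- exact: votes_tail_lt_half VK p12.
- exact: votes_tail_gt_half VK p12.
- have -> : (fun n => fine (Q [set w | V n w <= n%:R / 2])) =
      (fun n => (\sum_(k < n.+1 | (k.*2 <= n)%N) 'C(n, k))%:R / 2 ^+ n).
    by apply/funext => n; exact: votes_half_law (hit_features_indep VK) p12.
  exact: lower_half_bin_cvg.
Unshelve. all: by end_near. Qed.

End votes.

(** * Passage to the conditional law given the label *)

Section majority_vote.
Context (R : realType) d dX dT (Omega : measurableType d)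
  (X : measurableType dX) (Theta : measurableType dT).
Variables (P : probability Omega R)
  (x : {RV P >-> X}) (y : {RV P >-> bool}) (theta : nat -> {RV P >-> Theta})
  (Ptheta : probability Theta R) (f : X -> Theta -> bool).
Hypothesis hsetting : classifier_setting x y theta Ptheta f.

(** The fallback of [mnormalize] is ruled out, as the label event has positive finite mass. *)
Lemma cond_labelE c A : (0 < P (y @^-1` [set c]))%E ->
  cond_label P y c A =
    (P (A `&` y @^-1` [set c]) * (fine (P (y @^-1` [set c])))^-1%:E)%E.
Proof.
move=> c0; rewrite /cond_label /= /mnormalize /= /mrestr setTI.
rewrite ifF//; apply/negbTE; rewrite negb_or gt_eqF//=.
by rewrite -ltey ltey_eq fin_num_measure//; exact: measurable_label.
Qed.

(** Mutual independence is applied to the finite index set made of [None] and the first [r] draws,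
    listed without repetition by [s]. *)
Lemma sampling_independence W (B : nat -> set Theta) r :
  measurable W -> (forall j, measurable (B j)) ->
  P ((fun w => (x w, y w)) @^-1` W `&` \bigcap_(j in `I_r) theta j @^-1` B j) =
  (P ((fun w => (x w, y w)) @^-1` W) * \prod_(j < r) Ptheta (B j))%E.
Proof.
move=> mW mB; have [_ ind thetaE] := hsetting.
pose E o := if o is Some j then theta j @^-1` B j
            else (fun w => (x w, y w)) @^-1` W.
pose s : seq (option nat) := None :: [seq Some j | j <- iota 0 r].
have us : uniq s.
  rewrite /= map_inj_uniq ?iota_uniq; last by move=> ? ? [].
  by rewrite andbT; apply/negP => /mapP[].
have memE o : [set` seq_fset tt s] o = (o \in s).
  by rewrite -(seq_fsetE tt s).
have /= := ind (seq_fset tt s) E.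
rewrite (perm_big _ (seq_fset_perm tt s)) undup_id// big_cons big_map.
rewrite -[r in iota 0 r]subn0 -/(index_iota 0 r) big_mkord /=.
under [in X in _ -> X]eq_bigr => j _ do rewrite -(thetaE j).
have -> : \bigcap_(o in [set` seq_fset tt s]) E o =
    (fun w => (x w, y w)) @^-1` W `&` \bigcap_(j in `I_r) theta j @^-1` B j.
  apply/seteqP; split => w /=.
    move=> h; split; first by apply: (h None); rewrite memE inE.
    move=> j jr; apply: (h (Some j)); rewrite memE inE /=.
    by apply/mapP; exists j; rewrite ?mem_iota.
  move=> [hW hB] [j|]; last by [].
  rewrite memE inE /= => /mapP[i]; rewrite mem_iota /= add0n => ir [->].
  exact: hB.
apply=> -[j|] _ /=.
  by exists (B j); [exact: mB|rewrite setTI].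
by exists W; rewrite ?setTI.
Qed.

(** The label event is absorbed into the event about the data by taking [W] to be the rectangle of
    [U] and [[set c]]; the draws are independent of the pair [(x, y)]. *)
Lemma cond_independence c U (B : nat -> set Theta) r :
  (0 < P (y @^-1` [set c]))%E ->
  measurable U -> (forall j, measurable (B j)) ->
  cond_label P y c (x @^-1` U `&` \bigcap_(j in `I_r) theta j @^-1` B j) =
  (cond_label P y c (x @^-1` U) * \prod_(j < r) Ptheta (B j))%E.
Proof.
move=> c0 mU mB; rewrite !cond_labelE//.
have mUc : measurable (U `*` [set c]) by exact: measurableX.
have := @sampling_independence _ B r mUc mB.
have -> : (fun w => (x w, y w)) @^-1` (U `*` [set c]) =
    x @^-1` U `&` y @^-1` [set c] by [].
by rewrite setIAC => ->; rewrite muleAC.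
Qed.

Variable c : bool.
Hypothesis label_gt0 : (0 < P (y @^-1` [set c]))%E.

Let Q := cond_label P y c.
Let rate := mean_rate x y Ptheta f c.

Let hit_rate : fine (Q [set w | f (x w) (theta 0%N w)]) = rate.
Proof.
have [mf _ _] := hsetting.
rewrite (@hit_mean R _ _ _ _ _ _ Q x theta Ptheta f mf)//.
by move=> U B r mU mB; exact: cond_independence.
Qed.

Lemma cond_mean_rate n : cond_mean x y theta f c n = n%:R * rate.
Proof.
have [mf _ _] := hsetting.
rewrite /cond_mean (@votes_mean R _ _ _ _ _ _ Q x theta Ptheta f mf) /= ?hit_rate//.
by move=> U B r mU mB; exact: cond_independence.
Qed.

Lemma cond_votes_tail_cvg (s : R) :
  scaled_cond_var x y theta f c n @[n --> \oo] --> s%:E ->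
  fine (Q [set w | votes x theta f n w <= n%:R / 2]) @[n --> \oo]
    --> half_step rate.
Proof.
have [mf _ _] := hsetting.
move=> Vs; rewrite -hit_rate.
apply: (@votes_tail_cvg R _ _ _ _ _ _ Q x theta Ptheta f mf _ s Vs).
by move=> U B r mU mB; exact: cond_independence.
Qed.

Lemma cond_votes_tailC n :
  fine (Q [set w | votes x theta f n w > n%:R / 2]) =
  1 - fine (Q [set w | votes x theta f n w <= n%:R / 2]).
Proof.
have mtail : measurable [set w | votes x theta f n w <= n%:R / 2].
  rewrite -[X in measurable X]setTI; apply: measurable_fun_le => //.
  have [mf _ _] := hsetting.
  by apply: (@measurable_votes R _ _ _ _ _ _ Q x theta f mf).
have -> : [set w | votes x theta f n w > n%:R / 2] =
    ~` [set w | votes x theta f n w <= n%:R / 2].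
  by apply/seteqP; split => w /=; rewrite ltNge => /negP.
by rewrite probability_setC// fineB ?fin_num_measure.
Qed.

End majority_vote.

Theorem theorem1 (R : realType) (d dX dT : measure_display)
    (Omega : measurableType d) (X : measurableType dX)
    (Theta : measurableType dT) (P : probability Omega R)
    (x : {RV P >-> X}) (y : {RV P >-> bool})
    (theta : nat -> {RV P >-> Theta}) (Ptheta : probability Theta R)
    (f : X -> Theta -> bool)
    (hsetting : classifier_setting x y theta Ptheta f)
    (hprior : 0 < prior y < 1)
    (p q : R)
    (hp : p = mean_rate x y Ptheta f true)
    (hq : q = mean_rate x y Ptheta f false)
    (hp01 : 0 < p < 1) (hq01 : 0 < q < 1)
    (sigma_p sigma_q : R)
    (hsigma_p_gt0 : 0 < sigma_p) (hsigma_q_gt0 : 0 < sigma_q)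
    (hsigma_p : scaled_cond_var x y theta f true n @[n --> \oo]
                  --> (sigma_p ^+ 2)%:E)
    (hsigma_q : scaled_cond_var x y theta f false n @[n --> \oo]
                  --> (sigma_q ^+ 2)%:E) :
  Err x y theta f n @[n --> \oo] --> limit_error (prior y) p q /\
  Err_hat x y theta f sigma_p sigma_q n @[n --> \oo]
    --> limit_error (prior y) p q.
Proof.
have [prior_gt0 prior_lt1] := andP hprior.
have fin_true : P (y @^-1` [set true]) \is a fin_num.
  exact: fin_num_measure (measurable_label y true).
have true_gt0 : (0 < P (y @^-1` [set true]))%E by rewrite -(fineK fin_true) lte_fin.
have false_gt0 : (0 < P (y @^-1` [set false]))%E.
  have -> : y @^-1` [set false] = ~` (y @^-1` [set true]).
    by apply/seteqP; split => w /=; case: (y w).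
  rewrite probability_setC; last exact: measurable_label.
  by rewrite -(fineK fin_true) -EFinB lte_fin subr_gt0.
(* The nine cases collapse to one formula of the same shape as [Err] and [Err_hat], so each term can
   be treated separately. *)
have limE : limit_error (prior y) p q =
    half_step p * prior y + (1 - half_step q) * (1 - prior y).
  by rewrite /limit_error /half_step; case: (ltgtP q) => _; case: (ltgtP p) => _; field.
rewrite limE; split.
  apply: cvgD; apply: cvgMr_tmp.
    by rewrite hp; exact: (cond_votes_tail_cvg hsetting true_gt0 hsigma_p).
  under eq_cvg do rewrite (cond_votes_tailC hsetting).
  apply: cvgB; first exact: cvg_cst.
  by rewrite hq; exact: (cond_votes_tail_cvg hsetting false_gt0 hsigma_q).
rewrite /Err_hat.
under eq_cvg do rewrite (cond_mean_rate hsetting true_gt0)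
  (cond_mean_rate hsetting false_gt0) -hp -hq.
apply: cvgD; apply: cvgMr_tmp; first exact: Phi_standardized_cvg.
by apply: cvgB; [exact: cvg_cst|exact: Phi_standardized_cvg].
Qed.
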